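(* Let $K$ be an infinite integral domain, let $G=\{g_1,\ldots,g_n\}$ be a group of order $n$, and let $M_n(K)$ be equipped with the elementary $G$-grading induced by $(g_1,\ldots,g_n)$. Then $T_G(M_n(K),gl_n(K)) = J$, where $T_G(M_n(K),gl_n(K))$ is the set of all graded polynomial identities of the pair $(M_n(K),gl_n(K))$ and $J$ is the weak $T_G$-ideal of $K\langle X\rangle$ generated by all identities of type 1 and all identities of type 2.
   Context: Elementary grading: $e_{ij}$ denotes the matrix units of $M_n(K)$, and the elementary grading induced by $(g_1,\ldots,g_n)$ is the $G$-grading in which each $e_{ij}$ is homogeneous of degree $g_i^{-1}g_j$; the elements $g_1,\dots,g_n$ are all the (distinct) elements of $G$. $gl_n(K)=M_n(K)^{(-)}$ is $M_n(K)$ with the Lie product $[a,b]=ab-ba$, with the same grading. Free algebra: $\{X_g \mid g\in G\}$ is a family of disjoint countably infinite sets, $X=\bigcup_{g\in G}X_g$, and $K\langle X\rangle$ is the free associative unital $K$-algebra on $X$. For $x\in X_g$ put $\alpha(x)=g$; for a monomial $m=x_{i_1}\cdots x_{i_l}$ put $\alpha(m)=\alpha(x_{i_1})\cdots\alpha(x_{i_l})$, and $\alpha(1)=1_G$, where $1$ is the unity of $K\langle X\rangle$. $K\langle X\rangle$ is $G$-graded with $K\langle X\rangle_g$ the $K$-span of the monomials $m$ with $\alpha(m)=g$. $L$ is the Lie subalgebra of $K\langle X\rangle^{(-)}$ (the algebra $K\langle X\rangle$ with product $[a,b]=ab-ba$) generated by $X$. Graded identities of a pair: for a graded pair $(A,B)$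 ($A$ a $G$-graded associative algebra, $B$ a graded Lie subalgebra of $A^{(-)}$, $B_g=B\cap A_g$), $f(x_1,\ldots,x_m)\in K\langle X\rangle$ is a graded polynomial identity of $(A,B)$ if $f(b_1,\ldots,b_m)=0$ for all $b_1\in B_{\alpha(x_1)},\ldots,b_m\in B_{\alpha(x_m)}$. Weak $T_G$-ideal: an ideal $I$ of $K\langle X\rangle$ such that $\phi(I)\subset I$ for every graded endomorphism $\phi$ of $K\langle X\rangle$ with $\phi(x)\in L\cap K\langle X\rangle_{\alpha(x)}$ for all $x\in X$. The weak $T_G$-ideal generated by a set $S$ is the intersection of all weak $T_G$-ideals containing $S$. Identities of type 1: the polynomials $[h_1,h_2]$ where $h_1,h_2$ are monomials, $\alpha(h_1)=\alpha(h_2)=1_G$, and $h_1h_2$ is multilinear. Identities of type 2: the polynomials $h_1h_2h_3-h_3h_2h_1$ where $h_1,h_2,h_3$ are monomials, $\alpha(h_1)=\alpha(h_3)=(\alpha(h_2))^{-1}$, and $h_1h_2h_3$ is multilinear. *)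

(* Defs.v *)
From HB Require Import structures.
From mathcomp Require Import all_boot all_order all_algebra all_fingroup.
From mathcomp Require Import boolp classical_sets cardinality.
From mathcomp Require Import finmap.
From mathcomp.multinomials Require Import monalg.

Set Implicit Arguments.
Unset Strict Implicit.
Unset Printing Implicit Defensive.

Import GRing.Theory.

Local Open Scope classical_set_scope.
Local Open Scope ring_scope.

Section Algebras.
Context (R : comNzRingType).

Definition is_submodule (V : lmodType R) (S : set V) : Prop :=
  S 0 /\ forall (a : R) (u v : V), S u -> S v -> S (a *: u + v).

Definition module_span (V : lmodType R) (S : set V) : set V :=
  smallest (@is_submodule V) S.

Definition lie_bracket (A : pzRingType) (a b : A) : A := a * b - b * a.

Definition is_lie_subalgebra (A : lalgType R) (S : set A) : Prop :=
  is_submodule S /\ forall a b : A, S a -> S b -> S (lie_bracket a b).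

(* A two-sided ideal; it is automatically an R-submodule when A is unital. *)
Definition is_ideal (A : pzRingType) (I : set A) : Prop :=
  [/\ I 0,
      forall a b : A, I a -> I b -> I (a - b),
      forall a b : A, I b -> I (a * b) &
      forall a b : A, I a -> I (a * b)].

End Algebras.

(* The variables are the pairs (g, i), with X_g = {g} x nat. *)
Notation gvar gT := (gT * nat)%type.
Notation freealg K gT := {malg K[{fmonom gvar gT}]}.

Section GradedFreeAlgebra.
Context (K : comNzRingType) (gT : finGroupType).
Local Notation monom := {fmonom gvar gT}.
Local Notation "K<X>" := (freealg K gT).

Definition var (x : gvar gT) : K<X> := << fmu x >>.

Definition var_deg (x : gvar gT) : gT := x.1.

Definition mon_deg (m : monom) : gT := (\prod_(x <- m) var_deg x)%g.

Definition free_comp (g : gT) : set K<X> :=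
  module_span [set << m >> | m in [set m : monom | mon_deg m = g]].

Definition free_lie : set K<X> :=
  smallest (@is_lie_subalgebra K K<X>) (range var).

Definition graded_endo (phi : {lrmorphism K<X> -> K<X>}) : Prop :=
  forall (g : gT) (f : K<X>), free_comp g f -> free_comp g (phi f).

Definition is_weak_TG_ideal (I : set K<X>) : Prop :=
  is_ideal I /\
  forall phi : {lrmorphism K<X> -> K<X>}, graded_endo phi ->
    (forall x, (free_lie `&` free_comp (var_deg x)) (phi (var x))) ->
    phi @` I `<=` I.

Definition weak_TG_ideal_gen (S : set K<X>) : set K<X> :=
  smallest is_weak_TG_ideal S.

Definition multilinear (m : monom) : bool := uniq m.

Definition type1_identities : set K<X> :=
  [set f | exists h1 h2 : monom,
    [/\ mon_deg h1 = 1%g, mon_deg h2 = 1%g, multilinear (mmul h1 h2) &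
        f = lie_bracket << h1 >> << h2 >>]].

Definition type2_identities : set K<X> :=
  [set f | exists h1 h2 h3 : monom,
    [/\ mon_deg h1 = mon_deg h3, mon_deg h3 = (mon_deg h2)^-1%g,
        multilinear (mmul (mmul h1 h2) h3) &
        f = << h1 >> * << h2 >> * << h3 >> - << h3 >> * << h2 >> * << h1 >>]].

Definition eval (A : lalgType K) (b : gvar gT -> A) (f : K<X>) : A :=
  \sum_(m <- msupp f) f@_m *: \prod_(x <- (m : monom)) b x.

(* The identities of the pair (A, B), where A is graded by the A_g.  A
   substitution assigns a value to every variable, not only to those occurring
   in f; as 0 lies in every B_g this makes no difference. *)
Definition graded_identities (A : lalgType K) (A_ : gT -> set A) (B : set A) :
    set K<X> :=
  [set f | forall b : gvar gT -> A,
    (forall x, (B `&` A_ (var_deg x)) (b x)) -> eval b f = 0].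

Definition elem_grading (n : nat) (gs : 'I_n -> gT) (g : gT) : set 'M[K]_n :=
  module_span
    [set delta_mx ij.1 ij.2 | ij in
       [set ij : 'I_n * 'I_n | ((gs ij.1)^-1 * gs ij.2)%g = g]].

End GradedFreeAlgebra.

(* gl_n(K) = M_n(K)^(-), as a Lie subalgebra of itself. *)
Definition gl (K : comNzRingType) (n : nat) : set 'M[K]_n := [set: 'M[K]_n].

Arguments type1_identities K gT : clear implicits.
Arguments type2_identities K gT : clear implicits.
Arguments graded_identities {K gT} A A_ B.
Arguments gl K n : clear implicits.

(* Main.v *)
(* Read a monomial as a walk in G, each letter x being an edge v -> v * deg x
   labelled by x. Evaluated at homogeneous matrices, a monomial has in the row
   of g a single entry, the product of the values attached to the edges of its
   walk from g. As K is infinite, the coefficients of a graded identity sum to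
   zero over each class of monomials whose walks have the same edges. Two such
   walks are related by exchanging parallel subwalks,
   a h1 h2 h3 b -> a h3 h2 h1 b with h1, h3 from p to q and h2 from q to p.
   These exchanges are consequences of the identities of type 2; type 1 is the
   case h2 = 1. *)
Require Import Defs.
From HB Require Import structures.
From mathcomp Require Import all_boot all_order all_algebra all_fingroup.
From mathcomp Require Import boolp classical_sets cardinality.
From mathcomp Require Import finmap.
From mathcomp.multinomials Require Import monalg.

Set Implicit Arguments.
Unset Strict Implicit.
Unset Printing Implicit Defensive.

Import GRing.Theory.

Local Open Scope classical_set_scope.
Local Open Scope ring_scope.

(** * Walks in a group and exchanges of parallel subwalks *)

Section Trails.
Context (T : eqType) (gT : finGroupType) (d : T -> gT).
Implicit Types (p : gT) (s t : seq T).
Local Open Scope group_scope.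

Definition wdeg s : gT := \prod_(x <- s) d x.

Fixpoint edges p s : seq (T * gT) :=
  if s is x :: s' then (x, p) :: edges (p * d x) s' else [::].

Inductive swaps : seq T -> seq T -> Prop :=
| swaps_refl s : swaps s s
| swaps_step a h1 h2 h3 b of
    wdeg h1 = wdeg h3 & wdeg h3 = (wdeg h2)^-1 :
    swaps (a ++ h1 ++ h2 ++ h3 ++ b) (a ++ h3 ++ h2 ++ h1 ++ b)
| swaps_trans t s u of swaps s t & swaps t u : swaps s u.

Lemma wdeg_nil : wdeg [::] = 1.
Proof. exact: big_nil. Qed.

Lemma wdeg_cons x s : wdeg (x :: s) = d x * wdeg s.
Proof. exact: big_cons. Qed.

Lemma wdeg_cat s t : wdeg (s ++ t) = wdeg s * wdeg t.
Proof. exact: big_cat. Qed.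

Lemma edges_cat p s t : edges p (s ++ t) = edges p s ++ edges (p * wdeg s) t.
Proof.
elim: s p => [|x s IHs] p /=; first by rewrite wdeg_nil mulg1.
by rewrite IHs wdeg_cons mulgA.
Qed.

Lemma mem_edges p s x v :
  (x, v) \in edges p s ->
  exists s1 s2, s = s1 ++ x :: s2 /\ v = p * wdeg s1.
Proof.
elim: s p => //= y s IHs p.
rewrite inE => /orP[/eqP[-> ->]|/IHs[s1 [s2 [-> ->]]]].
  by exists [::], s; rewrite wdeg_nil mulg1.
by exists (y :: s1), s2; rewrite wdeg_cons mulgA.
Qed.

Lemma swaps_cons x s t : swaps s t -> swaps (x :: s) (x :: t).
Proof.
elim=> [u|a h1 h2 h3 b e1 e2|v u w _ IH1 _ IH2]; first exact: swaps_refl.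
  exact: (@swaps_step (x :: a)).
exact: swaps_trans IH1 IH2.
Qed.

Lemma swaps_wdeg s t : swaps s t -> wdeg s = wdeg t.
Proof.
elim=> [//|a h1 h2 h3 b e1 e2|v u w _ -> _ -> //].
by rewrite !wdeg_cat e1 e2.
Qed.

(** In both orders [h1] and [h3] start at one vertex and [h2] at their common end, so the three
    blocks of edges are merely permuted. *)
Lemma swaps_edges p s t : swaps s t -> perm_eq (edges p s) (edges p t).
Proof.
elim=> [//|a h1 h2 h3 b e1 e2|v u w _ IH1 _ IH2]; last first.
  exact: perm_trans IH1 IH2.
rewrite !edges_cat e1 e2 perm_cat2l !mulgKV.
by rewrite perm_catCA perm_sym perm_catCA perm_cat2l perm_catCA.
Qed.

Lemma edges_closed (V : set gT) p s :
  (forall x v, (x, v) \in edges p s -> V v -> V (v * d x)) -> V p ->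
  forall x v, (x, v) \in edges p s -> V v.
Proof.
elim: s p => //= y s IHs p closedV Vp x v.
rewrite inE => /orP[/eqP[_ ->] //|]; apply: IHs => [z w zw|].
  by apply: closedV; rewrite inE zw orbT.
by apply: (closedV y p) => //; rewrite mem_head.
Qed.

(* Otherwise a trail with the same edges as [u ++ x :: w] but beginning with
   [x] could never leave the vertices visited after [x], and so would miss the
   first edge of [u]. *)
Lemma trails_meet p x s y u w :
  wdeg (y :: u) = 1 ->
  perm_eq (edges p (x :: s)) (edges p ((y :: u) ++ x :: w)) ->
  exists u1 u2 w1 w2,
    [/\ y :: u = u1 ++ u2, w = w1 ++ w2 & wdeg u1 = wdeg (x :: w1)].
Proof.
move=> u1 E; apply: contrapT => disj.
(* [V] is the set of vertices visited after [x]; by [disj] the closed walk [y :: u] avoids it. *)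
pose V v := exists w1 w2, w = w1 ++ w2 /\ v = p * wdeg (x :: w1).
have VP v u1' u2 : y :: u = u1' ++ u2 -> v = p * wdeg u1' -> ~ V v.
  move=> eu -> [w1 [w2 [ew /mulgI e]]]; apply: disj.
  by exists u1', u2, w1, w2.
have E' : edges p ((y :: u) ++ x :: w) =
    edges p (y :: u) ++ (x, p) :: edges (p * d x) w.
  by rewrite edges_cat u1 mulg1.
have Vp : ~ V p by apply: (VP p [::] (y :: u)); rewrite // wdeg_nil mulg1.
(* An edge of [s] with source in [V] can only come from [w], so its target is in [V] too. *)
have srcV : forall z v, (z, v) \in edges (p * d x) s -> V v.
  apply: edges_closed => [z v zv Vv|]; last first.
    by exists [::], w; rewrite wdeg_cons wdeg_nil mulg1.
  have : (z, v) \in edges p (x :: s) by rewrite inE zv orbT.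
  rewrite (perm_mem E) E' mem_cat (in_cons (x, p)).
  move=> /or3P[/mem_edges|/eqP[_ ev]|/mem_edges].
  - by move=> [u1' [u2 [eu ev]]]; case: (VP v _ _ eu ev).
  - by case: Vp; rewrite -ev.
  - move=> [w1 [w2 [ew ->]]]; exists (rcons w1 z), w2; rewrite ew.
    rewrite cat_rcons -rcons_cons -cats1 wdeg_cat !wdeg_cons wdeg_nil mulg1.
    by rewrite !mulgA.
(* Count the edges with source [p]: only [x] on the left, as [p] is outside [V], but both [y] and
   [x] on the right. *)
have /seq.permP/(_ (fun e => e.2 == p)) := E; rewrite E' /= count_cat /= eqxx.
rewrite (eq_in_count (a2 := pred0)).
  by rewrite count_pred0 => /eqP; rewrite eqn_add2l addnCA.
move=> [z v] zv /=.
by apply/negP => /eqP ev; apply: Vp; rewrite -ev; apply: srcV zv.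
Qed.

(* Any two Eulerian trails of the same labelled multigraph with the same origin
   are related by exchanges of parallel subtrails. *)
Lemma edges_swaps p s t : perm_eq (edges p s) (edges p t) -> swaps s t.
Proof.
elim: s p t => [|x s IHs] p t E.
  by case: t E => [_|y t]; [exact: swaps_refl|rewrite perm_sym => /perm_nilP].
have : (x, p) \in edges p t by rewrite -(perm_mem E) mem_head.
move=> /mem_edges[u [w [et]]]; rewrite -{1}[p]mulg1 => /mulgI/esym u1.
(* Once exchanges bring [x] to the front of [t], both tails start at [p * d x] and have the same
   edges. *)
suff [t' st] : exists t', swaps (x :: t') t.
  apply: (swaps_trans _ st); apply/swaps_cons/(IHs (p * d x)).
  have st' := swaps_edges p st; rewrite perm_sym in st'.
  by have := perm_trans E st'; rewrite /= perm_cons.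
case: u u1 et => [_ ->|y u u1 et]; first by exists w; exact: swaps_refl.
rewrite et in E; have [u1' [u2 [w1 [w2 [eu ew e1]]]]] := trails_meet u1 E.
(* Exchange [u1'] with [x :: w1] around [u2], which leads back to [p] because [u1' ++ u2] is
   closed. *)
exists (w1 ++ u2 ++ u1' ++ w2); rewrite et eu ew.
have e2 : wdeg u1' = (wdeg u2)^-1.
  by apply/eqP; rewrite eq_mulgV1 invgK -wdeg_cat -eu u1.
have := @swaps_step [::] (x :: w1) u2 u1' w2 (esym e1) e2.
by rewrite /= -!catA.
Qed.

End Trails.

(** * Base-[N] digits and vanishing polynomial functions *)

Lemma big_count_digits (N M : nat) (s : seq nat) :
  all (fun i => i < M)%N s ->
  (\sum_(i <- s) N ^ i = \sum_(i < M) count_mem (i : nat) s * N ^ i)%N.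
Proof.
elim: s => [_|j s IHs /= /andP[jM /IHs IH]].
  by rewrite big_nil big1.
rewrite big_cons IH; under [RHS]eq_bigr do rewrite mulnDl.
rewrite big_split /=; congr addn.
rewrite (bigD1 (Ordinal jM)) //= eqxx mul1n big1 ?addn0 // => i.
by rewrite eq_sym -val_eqE /= => /negPf ->.
Qed.

Lemma digits_inj (N M : nat) (a b : nat -> nat) :
  (forall i, a i < N)%N -> (forall i, b i < N)%N ->
  (\sum_(i < M) a i * N ^ i = \sum_(i < M) b i * N ^ i)%N ->
  forall i, (i < M)%N -> a i = b i.
Proof.
elim: M a b => // M IHM a b aN bN.
have N0 : (0 < N)%N by apply: leq_ltn_trans (aN 0%N).
have shift (c : nat -> nat) : (\sum_(i < M.+1) c i * N ^ i =
    c 0 + (\sum_(i < M) c i.+1 * N ^ i) * N)%N.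
  rewrite big_ord_recl expn0 muln1 big_distrl /=; congr addn.
  by apply: eq_bigr => i _; rewrite -mulnA -expnSr.
rewrite !shift => e.
have e0 : a 0%N = b 0%N.
  have := congr1 (modn^~ N) e; rewrite /= ![(_ 0 + _)%N]addnC !modnMDl.
  by rewrite !modn_small.
move: e; rewrite e0 => /addnI/eqP; rewrite eqn_pmul2r // => /eqP e [//|i].
exact: (IHM (fun i => a i.+1) (fun i => b i.+1) (fun=> aN _) (fun=> bN _) e).
Qed.

(** Multiplicities act as digits in base [N]: they are bounded by the sizes, hence below [N], and no
    carry occurs. *)
Lemma sum_pow_inj (N : nat) (s t : seq nat) :
  (size s < N)%N -> (size t < N)%N ->
  (\sum_(i <- s) N ^ i = \sum_(i <- t) N ^ i)%N -> perm_eq s t.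
Proof.
move=> sN tN; set M := (\max_(i <- s ++ t) i).+1.
have M_ub i : i \in s ++ t -> (i < M)%N.
  by move=> ist; rewrite ltnS leq_bigmax_seq.
rewrite !(@big_count_digits N M); first last.
- by apply/allP => i i_s; apply: M_ub; rewrite mem_cat i_s.
- by apply/allP => i i_t; apply: M_ub; rewrite mem_cat i_t orbT.
move=> e; rewrite /perm_eq; apply/allP => i /M_ub iM /=; apply/eqP.
apply: (digits_inj (a := fun i => count_mem i s) (b := fun i => count_mem i t)
  _ _ e iM) => j; exact: leq_ltn_trans (count_size _ _) _.
Qed.

Lemma poly_fun_eq0 (K : idomainType) (P : {poly K}) :
  infinite_set [set: K] -> (forall z, P.[z] = 0) -> P = 0.
Proof.
move=> hK Pz; have [S _ szS] := infinite_set_fset (size P) hK.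
apply: contraTeq szS => P0; rewrite -ltnNge.
by apply: (max_poly_roots P0 _ (fset_uniq S)); apply/allP => z _; apply/eqP.
Qed.

(* Kronecker substitution [y t := z ^ (N ^ pickle t)], with [N] larger than all
   the degrees involved, reduces this to polynomials in one variable. *)
Lemma coef_class_eq0 (K : idomainType) (T : countType) (I : eqType)
    (r : seq I) (c : I -> K) (s : I -> seq T) :
  infinite_set [set: K] ->
  (forall y : T -> K, \sum_(i <- r) c i * \prod_(t <- s i) y t = 0) ->
  forall i0, i0 \in r -> \sum_(i <- r | perm_eq (s i) (s i0)) c i = 0.
Proof.
move=> hK r0 i0 i0r.
pose N := (\max_(i <- r) size (s i)).+1.
have sN i : i \in r -> (size (s i) < N)%N.
  by move=> ir; rewrite ltnS; apply: leq_bigmax_seq.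
(* The exponent of [z] to which the product over [u] specializes. *)
pose wt (u : seq T) := (\sum_(j <- map choice.pickle u) N ^ j)%N.
have wt_inj i : i \in r -> (wt (s i) == wt (s i0)) = perm_eq (s i) (s i0).
  move=> ir; apply/eqP/idP => [e|e]; last first.
    exact/perm_big/perm_map.
  apply: (perm_map_inj (pcan_inj choice.pickleK)); apply: (@sum_pow_inj N) e;
    by rewrite size_map sN.
have P0 : \sum_(i <- r) c i *: 'X^(wt (s i)) = 0 :> {poly K}.
  apply: poly_fun_eq0 hK _ => z.
  rewrite -[RHS](r0 (fun t => z ^+ (N ^ choice.pickle t))).
  rewrite horner_sum; apply: eq_bigr => i _.
  rewrite hornerZ hornerXn; congr (_ * _).
  rewrite /wt big_map.
  by elim/big_rec2: _ => [|t u v _ <-]; rewrite ?expr0 // exprD.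
have := congr1 (fun P : {poly K} => P`_(wt (s i0))) P0.
rewrite coef_sum coef0 => P0c; rewrite -[RHS]P0c.
rewrite [LHS]big_mkcond [LHS]big_seq [RHS]big_seq.
apply: eq_bigr => i ir; rewrite coefZ coefXn [in RHS]eq_sym wt_inj //.
by case: ifP; rewrite ?mulr1 ?mulr0.
Qed.

(** * Evaluation as an algebra morphism *)

Section Evaluation.
Context (K : comNzRingType) (gT : finGroupType).
Local Notation monom := {fmonom gvar gT}.
Local Notation "K<X>" := (freealg K gT).

Lemma malg_mon_prod (m : monom) :
  << m >> = \prod_(x <- (m : monom)) var K x :> K<X>.
Proof.
case: m => s /=; elim: s => [|x s IHs].
  by rewrite big_nil; congr << _ >>; apply/eqP; rewrite fmP fm1.
rewrite big_cons -IHs /var malgM_def fgmulUU mulr1; congr << _ >>.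
by apply/eqP; rewrite fmP fmM fmU.
Qed.

Lemma malg_monM (s t : seq (gvar gT)) :
  << FMonom (s ++ t) >> = << FMonom s >> * << FMonom t >> :> K<X>.
Proof. by rewrite !malg_mon_prod big_cat. Qed.

Section Morphism.
(* {malg K[M]} carries an algType structure only when M is commutative, hence
   the explicit hypothesis [scaleAr]. *)
Context (A : lalgType K) (b : gvar gT -> A).
Context (scaleAr : forall (c : K) (u v : A), c *: (u * v) = u * (c *: v)).

Definition monom_eval (m : monom) : A := \prod_(x <- (m : monom)) b x.

Lemma monom_eval_mmorphism : mmorphism monom_eval.
Proof.
by split=> [m1 m2|]; rewrite /monom_eval ?fmM ?big_cat // fm1 big_nil.
Qed.

HB.instance Definition _ :=
  isMultiplicative.Build _ _ monom_eval monom_eval_mmorphism.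

Lemma evalE (f : K<X>) : eval b f = mmap (in_alg A) monom_eval f.
Proof. by apply: eq_bigr => m _; rewrite /= mulr_algl. Qed.

Lemma eval_additive : zmod_morphism (eval b).
Proof. by move=> f g; rewrite !evalE raddfB. Qed.

Lemma eval_scalable : scalable (eval b).
Proof.
by move=> c f; rewrite !evalE mmapZ /= mulr_algl.
Qed.

Lemma eval_monoid_morphism : monoid_morphism (eval b).
Proof.
have comm_in_alg : forall (g : K<X>) m m',
    GRing.comm (in_alg A g@_m) (monom_eval m').
  by move=> g m m'; rewrite /GRing.comm /= mulr_algl -scaleAr mulr1.
have [eM e1] := commr_mmap_is_multiplicative comm_in_alg.
by split=> [|f g]; rewrite !evalE.
Qed.

Definition eval_morph : {lrmorphism K<X> -> A} :=
  HB.pack (eval b) (GRing.isZmodMorphism.Build _ _ _ eval_additive)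
    (GRing.isMonoidMorphism.Build _ _ _ eval_monoid_morphism)
    (GRing.isScalable.Build _ _ _ _ _ eval_scalable).

Lemma eval_mon (m : monom) : eval b << m >> = monom_eval m.
Proof. by rewrite evalE mmapU /= scale1r mul1r. Qed.

Lemma eval_var x : eval b (var K x) = b x.
Proof. by rewrite eval_mon /monom_eval fmU big_seq1. Qed.

End Morphism.
End Evaluation.

Lemma module_span_linear (K : comNzRingType) (V W : lmodType K)
    (phi : {linear V -> W}) (S : set V) (U : set W) :
  is_submodule U -> (forall v, S v -> U (phi v)) ->
  forall v, module_span S v -> U (phi v).
Proof.
move=> [U0 UD] SU v; apply: (smallest_sub (X := phi @^-1` U)) => //.
by split=> [|a u w Uu Uw] /=; rewrite ?linear0 // linearP; apply: UD.
Qed.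

Lemma module_span_submodule (K : comNzRingType) (V : lmodType K) (S : set V) :
  is_submodule (module_span S).
Proof.
split=> [U [[U0 _] _] //|a u v Su Sv U US].
by have [[_ UD] _] := US; apply: UD; [apply: Su|apply: Sv].
Qed.

Lemma submodule_sum (K : comNzRingType) (V : lmodType K) (S : set V)
    (I : Type) (r : seq I) (P : pred I) (c : I -> K) (v : I -> V) :
  is_submodule S -> (forall i, P i -> c i != 0 -> S (v i)) ->
  S (\sum_(i <- r | P i) c i *: v i).
Proof.
move=> [S0 SD] Sv; elim/big_rec: _ => // i u Pi Su.
have [->|ci0] := eqVneq (c i) 0; first by rewrite scale0r add0r.
by apply: SD => //; apply: Sv.
Qed.

Lemma sum_scalerB (K : nzRingType) (V : lmodType K) (I : Type) (r : seq I)
    (c : I -> K) (u v : I -> V) :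
  \sum_(i <- r) c i *: (u i - v i) =
  \sum_(i <- r) c i *: u i - \sum_(i <- r) c i *: v i.
Proof. by rewrite -sumrB; apply: eq_bigr => i _; rewrite scalerBr. Qed.

(** * Weak [T_G]-ideals of the free algebra *)

Section FreeAlgebra.
Context (K : comNzRingType) (gT : finGroupType).
Local Notation monom := {fmonom gvar gT}.
Local Notation "K<X>" := (freealg K gT).
Local Notation wdeg := (wdeg (@var_deg gT)).
Local Notation swaps := (swaps (@var_deg gT)).
Implicit Types (I : set K<X>) (s t h : seq (gvar gT)).

(** Scaling is multiplication by a constant, and constants are central. This supplies [scaleAr] for
    substitutions into the free algebra itself. *)
Lemma malg_scaleAr (c : K) (f g : K<X>) : c *: (f * g) = f * (c *: g).
Proof.
have cf : c%:MP * f = f * c%:MP :> K<X>.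
  rewrite !malgM_def fgmulUg fgmulgU; apply: eq_bigr => m _.
  by rewrite mul1m mulm1 mulrC.
rewrite -!mul_malgC.
have cfg := congr1 ( *%R^~ g) cf.
exact: etrans (mulrA _ _ _) (etrans cfg (esym (mulrA _ _ _))).
Qed.

Lemma malgZE (f : K<X>) : f = \sum_(m <- msupp f) f@_m *: << m >>.
Proof.
rewrite {1}[f]monalgE; apply: eq_bigr => m _.
by rewrite -mul_malgC malgM_def fgmulUU mulr1 mul1m.
Qed.

Lemma is_idealD I : is_ideal I -> forall f g, I f -> I g -> I (f + g).
Proof.
move=> [I0 IB _ _] f g If Ig; rewrite -[g]opprK -[- g]sub0r.
by apply: (IB) => //; apply: IB.
Qed.

Lemma is_idealZ I : is_ideal I -> forall (c : K) f, I f -> I (c *: f).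
Proof. by move=> [_ _ IM _] c f If; rewrite -mul_malgC; apply: IM. Qed.

Lemma is_ideal_sum I (J : Type) (r : seq J) (c : J -> K) (v : J -> K<X>) :
  is_ideal I -> (forall j, I (v j)) -> I (\sum_(j <- r) c j *: v j).
Proof.
move=> idI Iv; apply: submodule_sum => //; split; first by case: idI.
by move=> a u w Iu Iw; apply: is_idealD => //; apply: is_idealZ.
Qed.

(** Modulo [I] each monomial may be replaced by its representative, which makes [f] congruent to a
    vanishing sum. *)
Lemma is_ideal_rep I (rep : monom -> monom) (f : K<X>) :
  is_ideal I -> (forall m, I (<< m >> - << rep m >>)) ->
  \sum_(m <- msupp f) f@_m *: << rep m >> = 0 :> K<X> -> I f.
Proof.
move=> idI Irep frep.
suff -> : f = \sum_(m <- msupp f) f@_m *: (<< m >> - << rep m >>).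
  exact: (is_ideal_sum _ _ idI Irep).
have eB := sum_scalerB (msupp f) (mcoeff^~ f) (fun m => << m >>)
  (fun m => << rep m >> : K<X>).
by rewrite [RHS]eB [X in _ - X]frep subr0; exact: malgZE.
Qed.

Lemma weak_TG_ideal_gen_ideal (S : set K<X>) :
  is_weak_TG_ideal (weak_TG_ideal_gen S).
Proof.
split; first split.
- by move=> I [[[I0 _ _ _] _] _].
- move=> f g Sf Sg I IS; have [[[_ IB _ _] _] _] := IS.
  by apply: IB; [apply: Sf|apply: Sg].
- by move=> f g Sg I IS; have [[[_ _ IM _] _] _] := IS; apply: IM; apply: Sg.
- by move=> f g Sf I IS; have [[[_ _ _ IM] _] _] := IS; apply: IM; apply: Sf.
move=> phi gphi Lphi _ [f Sf <-] I IS; have [[_ Iphi] _] := IS.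
by apply: (Iphi phi) => //; exists f => //; apply: Sf.
Qed.

Lemma free_comp_mon (s : seq (gvar gT)) :
  free_comp (wdeg s) (<< FMonom s >> : K<X>).
Proof. by apply: sub_gen_smallest; exists (FMonom s). Qed.

Definition rename (r : gvar gT -> gvar gT) : {lrmorphism K<X> -> K<X>} :=
  eval_morph (fun x => var K (r x)) malg_scaleAr.

Lemma rename_mon r s : rename r << FMonom s >> = << FMonom (map r s) >>.
Proof.
by rewrite [LHS]eval_mon malg_mon_prod /monom_eval big_map.
Qed.

Lemma wdeg_map r s : (forall x, var_deg (r x) = var_deg x) ->
  wdeg (map r s) = wdeg s.
Proof. by move=> dr; rewrite /wdeg big_map; apply: eq_bigr. Qed.

Lemma weak_TG_ideal_rename I r f :
  is_weak_TG_ideal I -> (forall x, var_deg (r x) = var_deg x) ->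
  I f -> I (rename r f).
Proof.
move=> [_ Iphi] dr If; apply: (Iphi (rename r)); last by exists f.
  move=> g u; apply: module_span_linear => [|_ [m dm <-]].
    exact: module_span_submodule.
  rewrite -[m]fmK [X in free_comp _ X](rename_mon r m) -dm.
  by rewrite -[mon_deg m](wdeg_map _ dr); apply: free_comp_mon.
move=> x; rewrite [rename r _]eval_var.
split; first by apply: sub_gen_smallest; exists (r x).
rewrite -dr /= /var fmuE -[var_deg (r x)]mulg1.
by rewrite -[1%g](wdeg_nil (@var_deg gT)) -wdeg_cons; apply: free_comp_mon.
Qed.

(** The letter at position [k] is replaced by the variable of the same degree with index [k], and
    [r] reads it back. *)
Lemma multilinear_lift s : exists r t,
  [/\ forall x, var_deg (r x) = var_deg x, uniq t & map r t = s].
Proof.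
pose x0 : gvar gT := (1%g, 0).
(* The test keeps [r] degree-preserving outside [t], where [nth] may return a letter of another
   degree or the default [x0]. *)
pose r (x : gvar gT) :=
  if var_deg (nth x0 s x.2) == var_deg x then nth x0 s x.2 else x.
exists r, [seq (var_deg (nth x0 s k), k) | k <- iota 0 (size s)]; split.
- by move=> x; rewrite /r; case: eqP.
- by rewrite map_inj_uniq ?iota_uniq // => i j [].
- rewrite -map_comp -[RHS](mkseq_nth x0) /mkseq; apply: eq_map => k.
  by rewrite /r /= eqxx.
Qed.

(** Identities of type 2 are multilinear; repeated letters are reached by lifting to distinct
    variables and renaming back. *)
Lemma weak_TG_ideal_swap I h1 h2 h3 :
  is_weak_TG_ideal I -> type2_identities K gT `<=` I ->
  wdeg h1 = wdeg h3 -> wdeg h3 = ((wdeg h2)^-1)%g ->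
  I (<< FMonom (h1 ++ h2 ++ h3) >> - << FMonom (h3 ++ h2 ++ h1) >>).
Proof.
move=> TI SI e1 e2.
have [r [t [dr ut et]]] := multilinear_lift (h1 ++ h2 ++ h3).
have [k1 [k2 [k3 [ek eh1 eh2 eh3]]]] : exists k1 k2 k3,
    [/\ t = k1 ++ k2 ++ k3, h1 = map r k1, h2 = map r k2 & h3 = map r k3].
  exists (take (size h1) t), (take (size h2) (drop (size h1) t)),
    (drop (size h2) (drop (size h1) t)).
  rewrite !cat_take_drop !(map_take, map_drop) et drop_size_cat //.
  by rewrite !take_size_cat // drop_size_cat.
have -> : << FMonom (h1 ++ h2 ++ h3) >> - << FMonom (h3 ++ h2 ++ h1) >> =
    rename r (<< FMonom (k1 ++ k2 ++ k3) >> - << FMonom (k3 ++ k2 ++ k1) >>).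
  rewrite [RHS]raddfB; congr (_ - _); rewrite [RHS]rename_mon;
    by rewrite !map_cat -eh1 -eh2 -eh3.
apply: weak_TG_ideal_rename => //; apply: SI.
exists (FMonom k1), (FMonom k2), (FMonom k3); split.
- by rewrite -[LHS](wdeg_map _ dr) -[RHS](wdeg_map _ dr) /= -eh1 -eh3.
- by rewrite -[LHS](wdeg_map _ dr) /= -eh3 e2 eh2 wdeg_map.
- by rewrite /multilinear !fmM -catA -ek.
- by rewrite !malg_monM !mulrA.
Qed.

(** A single exchange is a difference from [weak_TG_ideal_swap] multiplied by [a] and [b]; chains of
    exchanges telescope. *)
Lemma weak_TG_ideal_swaps I s t :
  is_weak_TG_ideal I -> type2_identities K gT `<=` I ->
  swaps s t -> I (<< FMonom s >> - << FMonom t >>).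
Proof.
move=> TI SI; have [idI _] := TI; have [I0 IB IMl IMr] := idI.
have IT (f g h : K<X>) : I (f - g) -> I (g - h) -> I (f - h).
  by move=> fg gh; rewrite -(subrK g f) -addrA; apply: is_idealD.
elim=> [u|a h1 h2 h3 b e1 e2|u v w _ IH1 _ IH2]; first by rewrite subrr.
  have := weak_TG_ideal_swap TI SI e1 e2.
  move=> /(IMr _ << FMonom b >>) /(IMl << FMonom a >>).
  by rewrite mulrBl mulrBr -!malg_monM -!catA.
exact: IT IH1 IH2.
Qed.

End FreeAlgebra.

(** * Representatives of classes of monomials *)

Lemma perm_class_rep (M : choiceType) (T : eqType) (E : M -> seq T) :
  exists rep : M -> M, (forall m, perm_eq (E (rep m)) (E m)) /\
    forall m m', (rep m == rep m') = perm_eq (E m) (E m').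
Proof.
(* [choose] gives the same element from every starting point of a class. *)
pose rep m := choose (fun m' => perm_eq (E m') (E m)) m.
have rep_perm m : perm_eq (E (rep m)) (E m).
  exact: (chooseP (P := fun m' => perm_eq (E m') (E m))).
exists rep; split=> // m m'; apply/eqP/idP => [e|e].
  by apply: perm_trans (rep_perm m'); rewrite -e perm_sym.
rewrite /rep (eq_choose (Q := fun u => perm_eq (E u) (E m'))).
  exact: choose_id.
by move=> u; apply: (permPr e).
Qed.

(** The coefficient at [u] is the sum of the coefficients of [f] over the monomials represented by
    [u], possibly none. *)
Lemma malg_sum_rep (K : nzRingType) (M : choiceType) (f : {malg K[M]})
    (rep : M -> M) :
  (forall m0, m0 \in msupp f ->
    \sum_(m <- msupp f | rep m == rep m0) f@_m = 0) ->
  \sum_(m <- msupp f) f@_m *: << rep m >> = 0 :> {malg K[M]}.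
Proof.
move=> class0; apply/malgP => u; rewrite mcoeff0 raddf_sum /=.
have [/hasP[m0 m0f /eqP <-]|/hasPn nu] :=
    boolP (has (fun m => rep m == u) (msupp f)).
  rewrite -[RHS](class0 m0 m0f) [RHS]big_mkcond; apply: eq_bigr => m _.
  by rewrite mcoeffZ mcoeffU; case: eqP; rewrite ?mulr1 ?mulr0.
rewrite big_seq big1 // => m /nu.
by rewrite mcoeffZ mcoeffU => /negPf ->; rewrite mulr0.
Qed.

(** * Matrices with the elementary grading *)

Section ElementaryGrading.
Context (K : comNzRingType) (gT : finGroupType) (n : nat) (gs : 'I_n.+1 -> gT).
Context (gsi : gT -> 'I_n.+1) (gsK : cancel gs gsi) (gsiK : cancel gsi gs).
Local Notation "K<X>" := (freealg K gT).
Local Notation wdeg := (wdeg (@var_deg gT)).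
Local Notation edges := (edges (@var_deg gT)).
Local Notation swaps := (swaps (@var_deg gT)).

Lemma elem_gradingP g (A : 'M[K]_n.+1) :
  elem_grading gs g A <-> forall i j, A i j != 0 -> gs j = (gs i * g)%g.
Proof.
split=> [|A0].
  apply: (smallest_sub
    (X := [set A : 'M_n.+1 | forall i j, A i j != 0 -> gs j = (gs i * g)%g])).
    split=> [i j|a B C Bg Cg i j]; first by rewrite mxE eqxx.
    rewrite !mxE; have [B0|/Bg //] := eqVneq (B i j) 0.
    by rewrite B0 mulr0 add0r => /Cg.
  move=> _ [[i0 j0] /= <- <-] i j /=; rewrite mxE.
  have [->|_] := eqVneq i i0; have [->|_] := eqVneq j j0;
    by rewrite ?eqxx // mulKVg.
rewrite [A]matrix_sum_delta pair_big /=.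
apply: (submodule_sum _ (c := fun ij => A ij.1 ij.2)) => [|[i j] _ /= /A0 e].
  exact: module_span_submodule.
by apply: sub_gen_smallest; exists (i, j) => //=; rewrite e mulKg.
Qed.

Lemma elem_gradingE g (A : 'M[K]_n.+1) i j :
  elem_grading gs g A ->
  A i j = if gs j == (gs i * g)%g then A i (gsi (gs i * g)%g) else 0.
Proof.
move=> /elem_gradingP A0; case: eqP => [<-|ne]; first by rewrite gsK.
by apply/eqP; apply: contraT => /A0.
Qed.

(** By [elem_gradingE] each row of a factor has at most one nonzero entry, so the product expands
    along a single path, the walk from [gs i]. *)
Lemma prod_elem_grading (b : gvar gT -> 'M[K]_n.+1) (s : seq (gvar gT)) i j :
  (forall x, elem_grading gs (var_deg x) (b x)) ->
  (\prod_(x <- s) b x) i j =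
    if gs j == (gs i * wdeg s)%g then
      \prod_(e <- edges (gs i) s) b e.1 (gsi e.2) (gsi (e.2 * var_deg e.1)%g)
    else 0.
Proof.
move=> bg; elim: s i => [|x s IHs] i /=.
  by rewrite !big_nil wdeg_nil mulg1 mxE (can_eq gsK) eq_sym; case: eqP.
rewrite !big_cons /= -mulmxE mxE (bigD1 (gsi (gs i * var_deg x)%g)) //= big1.
  rewrite addr0 (elem_gradingE _ _ (bg x)) gsiK eqxx IHs gsiK wdeg_cons mulgA.
  rewrite gsK.
  by case: ifP; rewrite ?mulr0.
move=> k kne; rewrite (elem_gradingE _ _ (bg x)); case: eqP => [e|_].
  by rewrite -e gsK eqxx in kne.
by rewrite mul0r.
Qed.

(** As [K] is commutative, an entry depends only on the multiset of edges and the end of the walk,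
    both preserved by exchanges. *)
Lemma eval_swaps (b : gvar gT -> 'M[K]_n.+1) (s t : seq (gvar gT)) :
  (forall x, elem_grading gs (var_deg x) (b x)) ->
  swaps s t -> \prod_(x <- s) b x = \prod_(x <- t) b x.
Proof.
move=> bg st; apply/matrixP => i j; rewrite !prod_elem_grading //.
by rewrite (swaps_wdeg st) (perm_big _ (swaps_edges (gs i) st)).
Qed.

Lemma mx_scaleAr (c : K) (A B : 'M[K]_n.+1) : c *: (A * B) = A * (c *: B).
Proof. exact: scalerAr. Qed.

Lemma eval_free_comp (b : gvar gT -> 'M[K]_n.+1) g (f : K<X>) :
  (forall x, elem_grading gs (var_deg x) (b x)) ->
  free_comp g f -> elem_grading gs g (eval b f).
Proof.
move=> bg; rewrite -[eval b f]/(eval_morph b mx_scaleAr f).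
apply: module_span_linear => [|_ [m dm <-]]; first exact: module_span_submodule.
rewrite [X in elem_grading _ _ X]eval_mon.
apply/elem_gradingP => i j; rewrite /monom_eval prod_elem_grading // -dm.
by case: (gs j =P _); rewrite ?eqxx.
Qed.

Lemma eval_comp (A : lalgType K) (b : gvar gT -> A)
    (scaleAr : forall (c : K) (u v : A), c *: (u * v) = u * (c *: v))
    (phi : {lrmorphism K<X> -> K<X>}) (f : K<X>) :
  eval b (phi f) = eval (fun x => eval b (phi (var K x))) f.
Proof.
pose ev := eval_morph b scaleAr.
rewrite {1}[f]malgZE raddf_sum /= -[LHS]/(ev _) raddf_sum.
apply: eq_bigr => m _.
rewrite linearZ -[LHS]/(ev _) linearZ; congr (_ *: _).
by rewrite malg_mon_prod !rmorph_prod.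
Qed.

Lemma graded_identities_weak_TG_ideal :
  is_weak_TG_ideal
    (graded_identities 'M[K]_n.+1 (elem_grading gs) (gl K n.+1)).
Proof.
pose ev (b : gvar gT -> 'M[K]_n.+1) := eval_morph b (@mx_scaleAr).
split; first split.
- by move=> b _; rewrite -[LHS]/(ev b 0) raddf0.
- move=> f g If Ig b bg; rewrite -[LHS]/(ev b (f - g)) raddfB.
  by rewrite [X in X - _](If b bg) [X in _ - X](Ig b bg) subrr.
- move=> f g Ig b bg; rewrite -[LHS]/(ev b (f * g)) rmorphM.
  by rewrite [X in _ * X](Ig b bg) mulr0.
- move=> f g If b bg; rewrite -[LHS]/(ev b (f * g)) rmorphM.
  by rewrite [X in X * _](If b bg) mul0r.
move=> phi gphi phiL _ [f If <-] b bg; rewrite (eval_comp b mx_scaleAr).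
(* The matrices [eval b (phi (var x))] are again an admissible substitution, because [phi (var x)]
   is homogeneous of the degree of [x]. *)
apply: If => x; split=> //; apply: eval_free_comp.
  by move=> y; case: (bg y).
by case: (phiL x).
Qed.

Lemma graded_identities_swaps (s t : seq (gvar gT)) : swaps s t ->
  graded_identities 'M[K]_n.+1 (elem_grading gs) (gl K n.+1)
    (<< FMonom s >> - << FMonom t >>).
Proof.
move=> st b bg; rewrite -[LHS]/(eval_morph b mx_scaleAr _) raddfB.
rewrite [X in X - _]eval_mon [X in _ - X]eval_mon /monom_eval /=.
by rewrite (eval_swaps _ st) ?subrr // => x; case: (bg x).
Qed.

End ElementaryGrading.

(** * Coefficients of graded identities and the equality of ideals *)

Lemma graded_identity_class_eq0 (K : idomainType) (gT : finGroupType) (n : nat)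
    (gs : 'I_n.+1 -> gT) (gsi : gT -> 'I_n.+1) (f : freealg K gT) (i0 : 'I_n.+1)
    (m0 : {fmonom gvar gT}) :
  cancel gs gsi -> cancel gsi gs ->
  infinite_set [set: K] ->
  graded_identities 'M[K]_n.+1 (elem_grading gs) (gl K n.+1) f ->
  m0 \in msupp f ->
  \sum_(m <- msupp f |
      perm_eq (edges (@var_deg gT) (gs i0) m) (edges (@var_deg gT) (gs i0) m0))
    f@_m = 0.
Proof.
pose E (m : {fmonom gvar gT}) := edges (@var_deg gT) (gs i0) m.
move=> gsK gsiK hK If m0f.
(* The matrix entry examined below sees only monomials of the degree of [m0]; [c] discards the
   others. *)
pose c (m : {fmonom gvar gT}) :=
  if wdeg (@var_deg gT) m == wdeg (@var_deg gT) m0 then f@_m else 0.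
have c0 : \sum_(m <- msupp f |
    perm_eq (E m) (E m0)) c m = 0.
  apply: (coef_class_eq0 (s := E) hK _ m0f) => y.
  (* Generic homogeneous matrices: one free scalar [y (x, v)] for each edge labelled [x] with source
     [v]. *)
  pose b x : 'M[K]_n.+1 := \matrix_(i, j)
    if gs j == (gs i * var_deg x)%g then y (x, gs i) else 0.
  have bg x : elem_grading gs (var_deg x) (b x).
    apply/elem_gradingP => i j; rewrite mxE.
    by case: (gs j =P _); rewrite ?eqxx.
  have := If b (fun x => conj I (bg x)).
  move/matrixP/(_ i0 (gsi (gs i0 * wdeg (@var_deg gT) m0)%g)).
  rewrite summxE mxE => ev0; rewrite -[RHS]ev0; apply: eq_bigr => m _.
  rewrite mxE (prod_elem_grading gsK gsiK) // gsiK /c.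
  rewrite (inj_eq (mulgI _)) eq_sym; case: eqP; rewrite ?mul0r ?mulr0 // => _.
  congr (_ * _); apply: eq_bigr => -[x v] _; by rewrite mxE !gsiK eqxx.
(* Equal edges force equal degrees, so [c] discarded nothing from the class. *)
rewrite -[RHS]c0; apply: eq_bigr => m /edges_swaps/swaps_wdeg e.
by rewrite /c e eqxx.
Qed.

Theorem theorem6p1 (K : idomainType) (hK : infinite_set [set: K])
    (gT : finGroupType) (n : nat) (gs : 'I_n.+1 -> gT) (hgs : bijective gs) :
  graded_identities 'M[K]_n.+1 (elem_grading gs) (gl K n.+1)
  = weak_TG_ideal_gen (type1_identities K gT `|` type2_identities K gT).
Proof.
have [gsi gsK gsiK] := hgs.
apply/seteqP; split=> [f If|]; last first.
  apply: smallest_sub; first exact: graded_identities_weak_TG_ideal gsK gsiK.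
  move=> _ [[h1 [h2 [e1 e2 _ ->]]]|[h1 [h2 [h3 [e1 e2 _ ->]]]]].
    rewrite /lie_bracket -[h1]fmK -[h2]fmK -!malg_monM.
    apply: (graded_identities_swaps gsK gsiK).
    (* Type 1 exchanges [h1] and [h2] around the empty word. *)
    have := @swaps_step _ _ (@var_deg gT) [::] h1 [::] h2 [::].
    rewrite /= !cats0; apply; first exact: etrans e1 (esym e2).
    by rewrite wdeg_nil invg1.
  rewrite -[h1]fmK -[h2]fmK -[h3]fmK -!malg_monM -!catA.
  apply: (graded_identities_swaps gsK gsiK).
  have := @swaps_step _ _ (@var_deg gT) [::] h1 h2 h3 [::].
  by rewrite /= !cats0; apply.
set J := weak_TG_ideal_gen _.
have TJ : is_weak_TG_ideal J := weak_TG_ideal_gen_ideal _.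
have SJ : type2_identities K gT `<=` J.
  by move=> g Sg; apply: sub_gen_smallest; right.
(* One origin suffices: [edges_swaps] asks for equal edges from a single vertex. *)
have [rep [rep_perm rep_eq]] :=
  perm_class_rep (fun m : {fmonom gvar gT} => edges (@var_deg gT) (gs ord0) m).
apply: (is_ideal_rep (rep := rep)) => [|m|]; first by case: TJ.
  rewrite -[m in << m >>]fmK -[rep m]fmK.
  apply: weak_TG_ideal_swaps => //; apply: (@edges_swaps _ _ _ (gs ord0)).
  by rewrite perm_sym rep_perm.
apply: malg_sum_rep => m0 m0f; under eq_bigl do rewrite rep_eq.
exact: (graded_identity_class_eq0 ord0 gsK gsiK hK If m0f).
Qed.
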